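(* Let $H$ be a real Hilbert space and let $C\subset H$, $\mathcal{A}:H\to H$, $f:H\to H$, $\{\epsilon_n\}_{n\ge1}$ and $\{\varphi_n\}_{n\ge1}$ satisfy the following assumptions. (C1) $C$ is closed, convex and nonempty. (C2) $\mathrm{VI}(C,\mathcal{A})\neq\emptyset$. (C3) $\mathcal{A}$ is pseudomonotone on $H$ and $L$-Lipschitz continuous on $H$ (for some $L>0$), and sequentially weakly continuous on $C$. (C4) $f$ is $\rho$-contractive with $\rho\in[0,1)$. (C5) $\{\epsilon_n\}$ is a positive sequence and $\{\varphi_n\}\subset(0,1)$, with $\lim_{n\to\infty}\frac{\epsilon_n}{\varphi_n}=0$, $\lim_{n\to\infty}\varphi_n=0$ and $\sum_{n=1}^\infty\varphi_n=\infty$. Let $\delta>0$, $\gamma_1>0$, $\phi\in(0,1)$ and $x_0,x_1\in H$ be arbitrary, and let $\{x_n\}$ be the sequence generated by the inertial viscosity-type Tseng's extragradient algorithm described in the context. Then $\{x_n\}$ converges in norm to the point $u\in\mathrm{VI}(C,\mathcal{A})$ satisfying $u=P_{\mathrm{VI}(C,\mathcal{A})}(f(u))$.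
   Context: $\langle\cdot,\cdot\rangle$ and $\|\cdot\|$ are the inner product and norm of $H$. For a nonempty closed convex set $K\subset H$, $P_K:H\to K$ is the metric projection, i.e. $P_K(x)$ is the unique nearest point of $K$ to $x$. $\mathrm{VI}(C,\mathcal{A})=\{y^*\in C:\langle \mathcal{A}y^*,z-y^*\rangle\ge0\ \text{for all } z\in C\}$ is the solution set of the variational inequality problem. Definitions: $\mathcal{A}$ is pseudomonotone on $H$ if for all $p,q\in H$, $\langle\mathcal{A}p,q-p\rangle\ge0$ implies $\langle\mathcal{A}q,q-p\rangle\ge0$. $\mathcal{A}$ is $L$-Lipschitz continuous if $\|\mathcal{A}p-\mathcal{A}q\|\le L\|p-q\|$ for all $p,q\in H$. $\mathcal{A}$ is sequentially weakly continuous on $C$ if for every sequence $\{p_n\}\subset C$ converging weakly to a point $p$, $\{\mathcal{A}p_n\}$ converges weakly to $\mathcal{A}p$. $f$ is $\rho$-contractive if $\|f(x)-f(y)\|\le\rho\|x-y\|$ for all $x,y\in H$. Algorithm (the constant $\phi$ is distinct from the sequence $\{\varphi_n\}$): for each $n\ge1$, \[ \begin{aligned} s_n&=x_n+\delta_n(x_n-x_{n-1}),\\ y_n&=P_C(s_n-\gamma_n\mathcal{A}s_n),\\ z_n&=y_n-\gamma_n(\mathcal{A}y_n-\mathcal{A}s_n),\\ x_{n+1}&=\varphi_nf(z_n)+(1-\varphi_n)z_n, \end{aligned} \] where $\delta_n=\min\{\epsilon_n/\|x_n-x_{n-1}\|,\ \delta\}$ if $x_n\ne x_{n-1}$ and $\delta_n=\delta$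 otherwise, and $\gamma_{n+1}=\min\{\phi\|s_n-y_n\|/\|\mathcal{A}s_n-\mathcal{A}y_n\|,\ \gamma_n\}$ if $\mathcal{A}s_n-\mathcal{A}y_n\neq0$ and $\gamma_{n+1}=\gamma_n$ otherwise. *)

(* Defs.v *)
From HB Require Import structures.
From mathcomp Require Import all_boot all_order all_algebra.
From mathcomp Require Import all_classical all_reals all_analysis.

Set Implicit Arguments.
Unset Strict Implicit.
Unset Printing Implicit Defensive.

Import Order.TTheory GRing.Theory Num.Theory.
Import numFieldNormedType.Exports.

Local Open Scope classical_set_scope.
Local Open Scope ring_scope.

(* A real Hilbert space is a complete normed module [H] over a [realType]
   together with a positive definite symmetric bilinear form
   [dot : {dot H for idfun}] inducing the norm. *)
Definition induces_norm (R : realType) (H : completeNormedModType R)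
    (dot : {dot H for idfun}) : Prop :=
  forall p : H, `|p| = Num.sqrt (dot p p).

Definition nearest_point (R : realType) (H : completeNormedModType R)
    (K : set H) (p q : H) : Prop :=
  K q /\ forall z, K z -> `|p - q| <= `|p - z|.

(* [is_metric_proj K p q] renders [q = P_K p]: the nearest points of [K] to [p]
   are exactly [q], so both existence and uniqueness are asserted. *)
Definition is_metric_proj (R : realType) (H : completeNormedModType R)
    (K : set H) (p q : H) : Prop :=
  nearest_point K p = [set q].

Definition weakly_cvg (R : realType) (H : completeNormedModType R)
    (p : nat -> H) (l : H) : Prop :=
  forall g : {linear H -> R^o}, continuous g -> g (p n) @[n --> \oo] --> g l.

Definition seq_weakly_continuous_on (R : realType) (H : completeNormedModType R)
    (C : set H) (A : H -> H) : Prop :=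
  forall (p : nat -> H) (l : H), (forall n, C (p n)) -> weakly_cvg p l ->
    weakly_cvg (fun n => A (p n)) (A l).

Definition pseudomonotone (R : realType) (H : completeNormedModType R)
    (dot : {dot H for idfun}) (A : H -> H) : Prop :=
  forall p q : H, 0 <= dot (A p) (q - p) -> 0 <= dot (A q) (q - p).

Definition VI (R : realType) (H : completeNormedModType R)
    (dot : {dot H for idfun}) (C : set H) (A : H -> H) : set H :=
  [set y | C y /\ forall z, C z -> 0 <= dot (A y) (z - y)].

(* The sequences [eps], [vphi], [gam], [s], [y], [z] are indexed from 1 and [x]
   from 0; the values of the former at index 0 are irrelevant. *)
Record inertial_viscosity_tseng (R : realType) (H : completeNormedModType R)
    (C : set H) (A f : H -> H) (eps vphi : nat -> R) (delta phi : R)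
    (x s y z : nat -> H) (gam : nat -> R) : Prop := InertialViscosityTseng {
  tseng_s : forall n, (1 <= n)%N ->
    s n = x n + (if x n != x n.-1
                 then Num.min (eps n / `|x n - x n.-1|) delta
                 else delta) *: (x n - x n.-1);
  tseng_y : forall n, (1 <= n)%N ->
    is_metric_proj C (s n - gam n *: A (s n)) (y n);
  tseng_z : forall n, (1 <= n)%N ->
    z n = y n - gam n *: (A (y n) - A (s n));
  tseng_x : forall n, (1 <= n)%N ->
    x n.+1 = vphi n *: f (z n) + (1 - vphi n) *: z n;
  tseng_gam : forall n, (1 <= n)%N ->
    gam n.+1 = if A (s n) - A (y n) != 0
               then Num.min (phi * `|s n - y n| / `|A (s n) - A (y n)|) (gam n)
               else gam n
}.

(* Main.v *)
(* Let [u] solve [u = P_VI (f u)]. Once the step sizes have almost stabilised,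
   Tseng's estimate gives [|z n - u|^2 <= |s n - u|^2 - kappa |s n - y n|^2], so
   [a n := |x n - u|^2] satisfies, with [alpha n := (1 - rho) vphi n],
     [a (n+1) <= (1 - alpha n) (a n - kappa |s n - y n|^2)
                 + 2 vphi n <f u - u, x (n+1) - u> + o(alpha n)].
   By weak compactness, for every [eta > 0] there is [tau > 0] such that
   eventually [|s n - y n| < tau] forces [<f u - u, x (n+1) - u> <= eta]; when
   [|s n - y n| >= tau], the negative term absorbs the others because [vphi]
   tends to 0. Either way [a (n+1) <= (1 - alpha n) a n + alpha n eta'], whence
   [a n] tends to 0 since the [alpha n] have divergent sum. This dichotomy makes
   the usual extraction of subsequences along which [a] increases unnecessary. *)

Require Import Defs.
From HB Require Import structures.
From mathcomp Require Import all_boot all_order all_algebra.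
From mathcomp Require Import all_classical all_reals all_analysis.
From mathcomp Require Import ring lra.

Set Implicit Arguments.
Unset Strict Implicit.
Unset Printing Implicit Defensive.

Import Order.TTheory GRing.Theory Num.Theory.
Import numFieldNormedType.Exports.

Local Open Scope classical_set_scope.
Local Open Scope ring_scope.

(** * Elementary facts on real sequences and inequalities *)

(** The limit is the infimum, which is at least [m > 0] and hence strictly below [c] times itself.
    Applied to the step sizes, whose consecutive ratios must approach 1. *)
Lemma nonincreasing_ratio (R : realType) (u : nat -> R) (m c : R) :
  0 < m -> (forall n, m <= u n) -> (forall n, u n.+1 <= u n) -> 1 < c ->
  \forall n \near \oo, u n <= c * u n.+1.
Proof.
move=> m0 mu udec c1.
have ndec : nonincreasing_seq u by apply/nonincreasing_seqP.
have lbu : has_lbound (range u) by exists m => _ [n _ <-].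
have ucvg := nonincreasing_cvgn ndec lbu.
set l := inf _ in ucvg.
have ml : m <= l by apply: lb_le_inf => [|_ [n _ <-]//]; exists (u 0%N), 0%N.
have lu n : l <= u n by apply: ge_inf => //; exists n.
have : \forall n \near \oo, u n <= c * l by apply: (cvgr_le _ ucvg); nra.
by apply: filterS => n /le_trans; apply; rewrite ler_pM2l //; lra.
Qed.

(* As long as [a] exceeds [2 * eta] it decreases by at least
   [eta * (c * t n)] per step, and the sum of the [t n] diverges. *)
Lemma contractive_recurrence_le (R : realType) (a t : nat -> R) (c eta : R) :
  0 < c -> 0 < eta ->
  \sum_(1 <= k < n.+1) t k @[n --> \oo] --> +oo ->
  (\forall n \near \oo, 0 <= c * t n <= 1 /\
     a n.+1 <= (1 - c * t n) * a n + c * t n * eta) ->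
  \forall n \near \oo, a n <= 2 * eta.
Proof.
move=> c0 eta0 sumt [N _ aN].
(* A value at most [2 * eta] propagates: the next one is bounded by a convex combination of it and
   [eta]. *)
have [[m [Nm am]]|none] := pselect (exists m, (N <= m)%N /\ a m <= 2 * eta).
  exists m => // n /= mn; rewrite -(subnK mn) addnC.
  elim: (n - m)%N => [|k IH]; first by rewrite addn0.
  rewrite addnS; have [/andP[h0 h1] ha] := aN _ (leq_trans Nm (leq_addr k m)).
  nra.
have big n : (N <= n)%N -> 2 * eta < a n.
  by move=> Nn; rewrite ltNge; apply/negP => an; apply: none; exists n.
pose S n := \sum_(1 <= k < n.+1) t k.
have inv k : a (N + k).+1 + c * eta * S (N + k)%N <= a N.+1 + c * eta * S N.
  elim: k => [|k IH]; first by rewrite addn0.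
  apply: le_trans IH; rewrite addnS /S (big_nat_recr (N + k).+1) //=.
  have Nk : (N <= (N + k).+1)%N by rewrite leqW // leq_addr.
  have [/andP[h0 h1] ha] := aN _ Nk.
  by have := big _ Nk; move: (\sum_(_ <= _ < _) _) => S'; nra.
have ceta : 0 < c * eta by rewrite mulr_gt0.
(* Divergence makes [S] so large that [inv] forces a nonpositive value of [a], against [big]. *)
have /cvgryPge/(_ ((a N.+1 + c * eta * S N) / (c * eta)))[k _ hk] := sumt.
have := hk (N + k)%N (leq_addl _ _); rewrite /= -/(S _) ler_pdivrMr //.
have := inv k; have := big _ (leqW (leq_addr k N)); lra.
Qed.
Lemma le0_forall_small (R : realFieldType) (a c : R) :
  (forall t, 0 < t <= 1 -> a <= t * c) -> a <= 0.
Proof.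
move=> h; have [//|a0] := leP a 0; exfalso.
have hc : 0 < c by have := h 1; rewrite ltr01 lexx mul1r => /(_ isT); lra.
have d0 : 0 < a + 2 * c by lra.
(* This [t] would give [a + 2 * c <= c], although [a] and [c] are positive. *)
have t01 : 0 < a / (a + 2 * c) <= 1.
  by rewrite divr_gt0 //= ler_pdivrMr //; lra.
have := h _ t01; rewrite mulrAC ler_pdivlMr // ler_pM2l //; lra.
Qed.

Lemma convex_set_segment (R : realType) (E : lmodType R) (K : set E)
    (a b : E) (t : R) :
  convex_set K -> K a -> K b -> 0 <= t <= 1 -> K (a + t *: (b - a)).
Proof.
move=> cK Ka Kb /andP[t0 t1].
have := cK b a (Itv01 t0 t1) (mem_set Kb) (mem_set Ka).
rewrite inE -[conv _ _ _]/(t *: b + (1 - t) *: a); congr (K _).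
by rewrite scalerBl scale1r scalerBr addrC addrAC addrA.
Qed.

(** * Metric projections in a Hilbert space *)

Section hilbert.
Variables (R : realType) (H : completeNormedModType R) (dot : {dot H for idfun}).
Hypothesis hdot : induces_norm dot.
Implicit Types (a : R) (u v w p q h : H) (K : set H).

Lemma dotC u v : dot u v = dot v u.
Proof. by have := hermC dot u v; rewrite expr0 mul1r. Qed.

Lemma dotDl u v w : dot (u + v) w = dot u w + dot v w.
Proof. exact: linearDl. Qed.

Lemma dotNl u v : dot (- u) v = - dot u v.
Proof. exact: linearNl. Qed.

Lemma dotZl a u v : dot (a *: u) v = a * dot u v.
Proof. exact: linearZl_LR. Qed.

Lemma dot0l v : dot 0 v = 0.
Proof. exact: linear0l. Qed.

Lemma dotBl u v w : dot (u - v) w = dot u w - dot v w.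
Proof. by rewrite dotDl dotNl. Qed.

Lemma dotDr u v w : dot w (u + v) = dot w u + dot w v.
Proof. exact: linearDr. Qed.

Lemma dotNr u v : dot v (- u) = - dot v u.
Proof. exact: linearNr. Qed.

Lemma dotZr a u v : dot v (a *: u) = a * dot v u.
Proof. exact: linearZr_LR. Qed.

Lemma dot0r v : dot v 0 = 0.
Proof. exact: linear0r. Qed.

Lemma dotBr u v w : dot w (u - v) = dot w u - dot w v.
Proof. by rewrite dotDr dotNr. Qed.

Definition dotE := (dotDl, dotNl, dotZl, dot0l, dotDr, dotNr, dotZr, dot0r).

Lemma dot_norm u : dot u u = `|u| ^+ 2.
Proof.
rewrite hdot sqr_sqrtr //; have [->|/neq0_dnorm_gt0/ltW //] := eqVneq u 0.
by rewrite dot0r.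
Qed.

Lemma normD_sqr u v : `|u + v| ^+ 2 = `|u| ^+ 2 + 2 * dot u v + `|v| ^+ 2.
Proof. by rewrite -!dot_norm !dotE (dotC v u); ring. Qed.

Lemma normB_sqr u v : `|u - v| ^+ 2 = `|u| ^+ 2 - 2 * dot u v + `|v| ^+ 2.
Proof. by rewrite -!dot_norm !dotE (dotC v u); ring. Qed.

(* The norm being given, Cauchy-Schwarz is read off the triangle inequality. *)
Lemma dot_le u v : dot u v <= `|u| * `|v|.
Proof.
have : `|u + v| ^+ 2 <= (`|u| + `|v|) ^+ 2.
  by rewrite ler_pXn2r ?nnegrE ?addr_ge0 ?ler_normD.
rewrite normD_sqr; nra.
Qed.

Lemma norm_dot_le u v : `|dot u v| <= `|u| * `|v|.
Proof.
rewrite ler_norml dot_le andbT lerNl -dotNl.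
by rewrite (le_trans (dot_le _ _)) // normrN.
Qed.

Lemma cvg_dotr (T : Type) (F : set_system T) (FF : Filter F) h (p : T -> H) l :
  p @ F --> l -> dot h (p n) @[n --> F] --> dot h l.
Proof.
move=> pl; apply/cvgrPdist_lt => e e0.
have h0 : 0 < `|h| + 1 by rewrite ltr_wpDl.
have /cvgrPdist_lt/(_ (e / (`|h| + 1))) := pl.
rewrite divr_gt0 // => /(_ isT); apply: filterS => n.
rewrite ltr_pdivlMr // -dotBr; apply: le_lt_trans.
rewrite (le_trans (norm_dot_le _ _)) // mulrC ler_wpM2l //; lra.
Qed.

(** Compare [q] with [q + t *: (z - q)]: expanding the square and dividing by [t] bounds twice the
    inner product by [t] times a constant, and [t] tends to 0. The converse is the same expansion at
    [t = 1]. *)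
Lemma nearest_pointP K p q : convex_set K ->
  nearest_point K p q <-> K q /\ forall z, K z -> dot (p - q) (z - q) <= 0.
Proof.
move=> cK; split=> -[Kq hq]; split=> // z Kz.
  suff : 2 * dot (p - q) (z - q) <= 0 by lra.
  apply: (@le0_forall_small _ _ (`|z - q| ^+ 2)) => t /andP[t0 t1].
  have /hq : K (q + t *: (z - q)).
    by apply: convex_set_segment => //; rewrite ltW.
  rewrite -(ler_pXn2r (n := 2)) ?nnegrE // opprD addrA (normB_sqr (p - q)).
  rewrite dotZr normrZ (gtr0_norm t0) /=.
  set D := dot _ _; rewrite exprMn => hle; rewrite -(ler_pM2l t0); nra.
have hqz := hq z Kz; rewrite -(ler_pXn2r (n := 2)) ?nnegrE //.
have -> : p - z = (p - q) - (z - q) by rewrite opprB addrA subrK.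
rewrite (normB_sqr (p - q)).
have := sqr_ge0 `|z - q|; lra.
Qed.

(** Uniqueness: the inequalities of two nearest points, each tested at the other, add up to
    [|r - q| ^+ 2 <= 0]. *)
Lemma is_metric_projP K p q : convex_set K ->
  is_metric_proj K p q <-> K q /\ forall z, K z -> dot (p - q) (z - q) <= 0.
Proof.
move=> cK; rewrite -nearest_pointP //; split=> [->//|npq].
apply/seteqP; split=> [r /= npr|_ ->//].
have [Kq hq] := (nearest_pointP p q cK).1 npq.
have [Kr hr] := (nearest_pointP p r cK).1 npr.
have : `|r - q| ^+ 2 <= 0.
  have := hq _ Kr; have := hr _ Kq.
  by rewrite -dot_norm !dotE (dotC q r); lra.
rewrite exprn_even_le0 //= normr_eq0 subr_eq0 => /eqP; exact.
Qed.

(** A minimising sequence is Cauchy, so completeness and closedness provide the point. *)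
Lemma metric_proj_exists K p : closed K -> convex_set K -> K !=set0 ->
  exists q, is_metric_proj K p q.
Proof.
move=> clK cK [k0 Kk0].
suff [q npq] : exists q, nearest_point K p q.
  by exists q; apply/is_metric_projP => //; apply/nearest_pointP.
pose D := [set `|p - z| | z in K].
have D0 : D !=set0 by exists `|p - k0|; exists k0.
have Dlb : has_lbound D by exists 0 => _ [z _ <-].
pose d := inf D.
have dle z : K z -> d <= `|p - z| by move=> Kz; apply: ge_inf => //; exists z.
have d0 : 0 <= d by apply: lb_le_inf => // _ [z _ <-].
have /choice[z zP] (n : nat) : exists z, K z /\ `|p - z| < d + n.+1%:R^-1.
  have n0 : 0 < n.+1%:R^-1 :> R by rewrite invr_gt0.
  have [_ [z Kz <-] hz] := inf_adherent n0 (conj D0 Dlb).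
  by exists z.
(* Parallelogram identity, the midpoint of [z n] and [z m] being in [K]. *)
have zz n m : `|z n - z m| ^+ 2 <=
    2 * (2 * d + 1) * (n.+1%:R^-1 + m.+1%:R^-1).
  have [Kn hn] := zP n; have [Km hm] := zP m.
  have /dle dm : K (z n + 2^-1 *: (z m - z n)).
    by apply: convex_set_segment => //; lra.
  have i1 (k : nat) : 0 < (k.+1%:R^-1 : R) <= 1.
    by rewrite invr_gt0 ltr0n /= invf_le1 // ler1n.
  have /andP[] := i1 n; have /andP[] := i1 m.
  move: (n.+1%:R^-1) (m.+1%:R^-1) hn hm => a b hn hm b0 b1 a0 a1.
  have sq_d : d ^+ 2 <= `|p - (z n + 2^-1 *: (z m - z n))| ^+ 2.
    by rewrite ler_pXn2r ?nnegrE.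
  have sq_n : `|p - z n| ^+ 2 <= (d + a) ^+ 2.
    by rewrite ler_pXn2r ?nnegrE //; lra.
  have sq_m : `|p - z m| ^+ 2 <= (d + b) ^+ 2.
    by rewrite ler_pXn2r ?nnegrE //; lra.
  have -> : `|z n - z m| ^+ 2 = 2 * `|p - z n| ^+ 2 + 2 * `|p - z m| ^+ 2
      - 4 * `|p - (z n + 2^-1 *: (z m - z n))| ^+ 2.
    rewrite -!dot_norm !dotE (dotC (z n) p) (dotC (z m) p) (dotC (z m) (z n)).
    by field.
  nra.
have cz : cauchy (z @ \oo).
  apply: cauchy_exP => e e0.
  have c0 : 0 < 4 * (2 * d + 1) by lra.
  (* With each of the two reciprocals below this value, the bound in [zz] is below [e ^+ 2]. *)
  have e1 : 0 < e ^+ 2 / (4 * (2 * d + 1)) by rewrite divr_gt0 ?exprn_gt0.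
  have [N _ hN] := near_infty_natSinv_lt (PosNum e1).
  exists (z N), N => // n /= Nn.
  rewrite -ball_normE /= -(ltr_pXn2r (n := 2)) ?nnegrE // ?ltW //.
  apply: (le_lt_trans (zz _ _)).
  have := hN N (leqnn N); have := hN n Nn; rewrite /= !ltr_pdivlMr //.
  by move: (N.+1%:R^-1) (n.+1%:R^-1) => a b; lra.
have /cauchy_cvgP/cvg_ex[q zq] := cz.
exists q; split.
  by apply: (closed_cvg K) zq => //; apply: nearW => n; case: (zP n).
move=> y Ky; apply: le_trans (dle y Ky).
apply: (@ler_cvg_to nat \oo _ _ (fun n => `|p - z n|) (fun n => d + n.+1%:R^-1)).
- by apply: cvg_norm; apply: cvgB => //; exact: cvg_cst.
- rewrite -[X in _ --> X]addr0; apply: cvgD; first exact: cvg_cst.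
  exact: cvg_harmonic.
- by apply: nearW => n; have [_ /ltW] := zP n.
Qed.

(** * Weak convergence *)

(** The projection [q] of 0 onto the hyperplane [g = 1] is orthogonal to the kernel of [g], so [q]
    divided by [|q| ^+ 2] represents [g]. Linearity is a plain equation because [g] will also be a
    limit along an ultrafilter. *)
Lemma riesz (g : H -> R) :
  (forall a u v, g (a *: u + v) = a * g u + g v) -> continuous g ->
  exists h, forall u, g u = dot h u.
Proof.
move=> glin gcont.
have g0 : g 0 = 0 by have := glin 1 0 0; rewrite scaler0 addr0; lra.
have gZ a u : g (a *: u) = a * g u by rewrite -[a *: u]addr0 glin g0 addr0.
have gD u v : g (u + v) = g u + g v by rewrite -[u]scale1r glin mul1r scale1r.
have [[e ge]|/forallNP gall0] := pselect (exists e, g e != 0); last first.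
  by exists 0 => u; rewrite dot0l; apply/eqP/negPn/negP/gall0.
pose K := [set u | g u = 1].
have clK : closed K.
  apply: (@preimage_closed _ _ g [set 1]); last exact: closed_eq.
  by move=> x _; exact: gcont.
have cK : convex_set K.
  move=> u v t; rewrite !inE /K /= => gu gv.
  rewrite -[conv t u v]/(t%:num *: (u : H) + (1 - t%:num) *: (v : H)).
  by rewrite gD !gZ gu gv; lra.
have K0 : K !=set0 by exists ((g e)^-1 *: e); rewrite /K /= gZ mulVf.
have [q /is_metric_projP[//|gq hq]] := metric_proj_exists 0 clK cK K0.
have orth v : g v = 0 -> dot q v = 0.
  (* Both [q + v] and [q - v] lie in [K], so the projection inequality holds with either sign. *)
  move=> gv; have := hq (q + v); have := hq (q + (-1) *: v).
  rewrite /K /= !gD gZ gv mulr0 addr0 gq ![q + _ - q]addrAC subrr !add0r.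
  by rewrite !dotE => /(_ erefl) ? /(_ erefl) ?; lra.
have q0 : `|q| ^+ 2 != 0.
  rewrite expf_neq0 // normr_eq0; apply/eqP => q0.
  by move: gq; rewrite /K /= q0 g0; lra.
exists ((`|q| ^+ 2)^-1 *: q) => u.
have : dot q (u + (- g u) *: q) = 0.
  by apply: orth; rewrite gD gZ gq; lra.
rewrite !dotE dot_norm => hu.
have -> : dot q u = g u * `|q| ^+ 2 by lra.
by rewrite mulrCA mulVf // mulr1.
Qed.

Lemma weakly_cvgP (p : nat -> H) l :
  weakly_cvg p l <-> forall h, dot h (p n) @[n --> \oo] --> dot h l.
Proof.
split=> [pl h|pl g gc].
  have hlin : linear (dot h : H -> R^o) by move=> a u v; rewrite !dotE.
  pose g : {linear H -> R^o} :=
    HB.pack (dot h : H -> R^o) (GRing.isLinear.Build _ _ _ _ _ hlin).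
  by apply: (pl g) => u; apply: cvg_dotr.
have [h gh] := riesz (g := g) (fun a u v => linearP g a u v) gc.
by rewrite gh; under eq_fun do rewrite gh; apply: pl.
Qed.

(** Compactness of the segment gives a cluster point, and a cluster point of an ultrafilter is a
    limit. *)
Lemma ultra_bounded_cvg (T : Type) (U : set_system T) (f : T -> R) (B : R) :
  UltraFilter U -> (forall n, `|f n| <= B) -> exists l : R, f x @[x --> U] --> l.
Proof.
move=> UU fB.
have PU : ProperFilter U := ultra_proper.
have [|l [_ cl]] := @segment_compact R (- B) B (f @ U) _.
  by apply: (filterE (F := U)) => n; rewrite /= in_itv /= -ler_norml fB.
exists l => N Nl; rewrite /= nbhs_simpl /=.
have [//|UnN] := in_ultra_setVsetC (f @^-1` N) UU.
by have [x []] := cl (~` N) N UnN Nl.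
Qed.

(* Along an ultrafilter the bounded sequence [p] has a weak limit [w]; a
   subsequence then only has to be tested against the countably many vectors
   [p j] and [w]. *)
Lemma bounded_weakly_cvg_subseq (p : nat -> H) B : (forall n, `|p n| <= B) ->
  exists (sigma : nat -> nat) w,
    (forall k, (k <= sigma k)%N) /\ weakly_cvg (p \o sigma) w.
Proof.
move=> pB.
have B0 : 0 <= B by apply: le_trans (pB 0%N).
have [U [UU sU]] := ultraFilterLemma (eventually_filter).
have PU : ProperFilter U := ultra_proper.
have dB h n : `|dot h (p n)| <= `|h| * B.
  by rewrite (le_trans (norm_dot_le _ _)) // ler_wpM2l.
(* The limits along [U] form a bounded linear functional, which Riesz represents by [w]. *)
have /choice[g gP] : forall h, exists l : R, dot h (p n) @[n --> U] --> l.
  by move=> h; apply: ultra_bounded_cvg (dB h).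
have glin a u v : g (a *: u + v) = a * g u + g v.
  apply: cvg_unique (gP _) _ => //.
  rewrite (_ : (fun n => _) = fun n => a * dot u (p n) + dot v (p n)).
    by apply: cvgD => //; apply: cvgM => //; exact: cvg_cst.
  by apply/funext => n; rewrite dotDl dotZl.
have gB u : `|g u| <= `|u| * B.
  apply: (closed_cvg [set x : R | `|x| <= `|u| * B]) (gP u).
    apply: (@preimage_closed _ _ (fun x : R => `|x|) [set x | x <= `|u| * B]).
      by move=> x _; exact: norm_continuous.
    exact: closed_le.
  by apply: nearW => n; exact: dB.
have gcont : continuous g.
  move=> u; apply/cvgrPdist_lt => e e0.
  have B1 : 0 < B + 1 by lra.
  have : \forall v \near u, `|u - v| < e / (B + 1).
    by apply: cvgr_dist_lt; rewrite ?divr_gt0.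
  apply: filterS => v; rewrite ltr_pdivlMr //; apply: le_lt_trans.
  have -> : g u - g v = g (u - v) by rewrite (addrC u) -(scaleN1r v) glin; lra.
  by rewrite (le_trans (gB _)) // ler_wpM2l //; lra.
have [w wP] := riesz glin gcont.
have gw h : dot h (p n) @[n --> U] --> dot h w by rewrite dotC -wP.
(* The finitely many conditions of stage [m] hold on a member of [U], which is nonempty. *)
have /choice[sigma sigmaP] (m : nat) : exists n, (m <= n)%N /\
    `|dot w w - dot w (p n)| < m.+1%:R^-1 /\
    forall j : 'I_m.+1, `|dot (p j) w - dot (p j) (p n)| < m.+1%:R^-1.
  have m0 : 0 < m.+1%:R^-1 :> R by rewrite invr_gt0.
  apply: (filter_ex (F := U)); near=> n; split; last split.
  - by near: n; apply: sU; exists m.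
  - by near: n; apply: cvgr_dist_lt.
  - by near: n; apply: filter_forall => j; apply: cvgr_dist_lt.
exists sigma, w; split => [k|]; first by have [] := sigmaP k.
apply/weakly_cvgP.
(* [G] is a closed subspace containing [w] and every [p j]. *)
pose G := [set h | dot h (p (sigma k)) @[k --> \oo] --> dot h w].
have harm e : 0 < e -> \forall k \near \oo, k.+1%:R^-1 < e :> R.
  by move=> e0; have := near_infty_natSinv_lt (PosNum e0).
have Gw : G w.
  apply/cvgrPdist_lt => e /harm; apply: filterS => k.
  by have [_ [? _]] := sigmaP k; apply: lt_trans.
have Gp j : G (p j).
  apply/cvgrPdist_lt => e /harm ke; near=> k.
  have jk : (j < k.+1)%N by rewrite ltnS; near: k; exists j.
  have [_ [_ /(_ (Ordinal jk)) /=]] := sigmaP k.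
  by move=> /lt_trans; apply; near: k.
have GD u v : G u -> G v -> G (u + v).
  move=> Gu Gv; rewrite /G /= dotDl.
  rewrite (_ : (fun k => _) = fun k => dot u (p (sigma k)) + dot v (p (sigma k))).
    exact: cvgD.
  by apply/funext => k; rewrite dotDl.
have GZ a u : G u -> G (a *: u).
  move=> Gu; rewrite /G /= dotZl.
  rewrite (_ : (fun k => _) = fun k => a * dot u (p (sigma k))).
    by apply: cvgM => //; exact: cvg_cst.
  by apply/funext => k; rewrite dotZl.
have clG : closed G.
  move=> h clh; apply/cvgrPdist_lt => e e0.
  have c0 : 0 < 2 * (`|w| + B + 1) by have := normr_ge0 w; lra.
  have [h' [Gh']] := clh _ (nbhsx_ballx h _ (divr_gt0 e0 c0)).
  rewrite -ball_normE /= ltr_pdivlMr // => hh'.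
  have : \forall k \near \oo, `|dot h' w - dot h' (p (sigma k))| < e / 2.
    by apply: cvgr_dist_lt => //; lra.
  apply: filterS => k hk.
  have -> : dot h w - dot h (p (sigma k)) = dot (h - h') (w - p (sigma k))
       + (dot h' w - dot h' (p (sigma k))) by rewrite !dotE; ring.
  have i1 := norm_dot_le (h - h') (w - p (sigma k)).
  have i2 : `|w - p (sigma k)| <= `|w| + B.
    by rewrite (le_trans (ler_normB _ _)) // lerD2l.
  have := ler_normD (dot (h - h') (w - p (sigma k)))
    (dot h' w - dot h' (p (sigma k))).
  have := ler_wpM2l (normr_ge0 (h - h')) i2.
  by have := normr_ge0 (h - h'); lra.
have cG : convex_set G.
  move=> u v t; rewrite !inE => Gu Gv.
  rewrite -[conv t u v]/(t%:num *: (u : H) + (1 - t%:num) *: (v : H)).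
  by apply: GD; apply: GZ.
move=> h.
(* Split [h] along [G]: the part [h - q] is orthogonal to [w] and to every [p j], so its products
   are constantly 0. *)
have [q /is_metric_projP[//|Gq hq]] := metric_proj_exists h clG cG (ex_intro _ w Gw).
have orth v : G v -> dot (h - q) v = 0.
  move=> Gv; have := hq _ (GD _ _ Gq Gv); have := hq _ (GD _ _ Gq (GZ (-1) _ Gv)).
  by rewrite ![q + _ - q]addrAC subrr !add0r dotZr; lra.
suff : G ((h - q) + q) by rewrite subrK.
apply: GD => //; rewrite /G /= (orth _ Gw).
rewrite (_ : (fun k => _) = fun=> 0); first exact: cvg_cst.
by apply/funext => k; rewrite (orth _ (Gp _)).
Unshelve. all: by end_near. Qed.

(** With [q] the projection of [w], the inequality [dot (w - q) (p n - q) <= 0] passes to the weak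
    limit and forces [w = q]. *)
Lemma weakly_closed_convex K (p : nat -> H) w : closed K -> convex_set K ->
  (forall n, K (p n)) -> weakly_cvg p w -> K w.
Proof.
move=> clK cK Kp /weakly_cvgP pw.
have [q /is_metric_projP[//|Kq hq]] :=
  metric_proj_exists w clK cK (ex_intro _ _ (Kp 0%N)).
suff : dot (w - q) w <= dot (w - q) q.
  rewrite -subr_le0 -dotBr dot_norm exprn_even_le0 //= normr_eq0 subr_eq0.
  by move=> /eqP ->.
apply: (ler_cvg_to (pw _) (cvg_cst _)); apply: nearW => n.
by rewrite -subr_le0 -dotBr hq.
Qed.

(** * Pseudomonotone variational inequalities *)

Section variational_inequality.
Variables (C : set H) (A : H -> H) (L : R).
Hypotheses (C_closed : closed C) (C_convex : convex_set C).
Hypotheses (A_pseudomonotone : pseudomonotone dot A) (A_lipschitz : L.-lipschitz A).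

Let A_lip u v : `|A u - A v| <= L * `|u - v|.
Proof. exact: (@A_lipschitz (u, v) (conj I I)). Qed.

(** One direction is pseudomonotonicity; for the other, test at [w + t *: (z - w)], divide by [t]
    and let [t] tend to 0 by the Lipschitz bound. The new inequality is affine in [w], whence
    closedness and convexity of the solution set. *)
Lemma minty w : VI dot C A w <-> C w /\ forall z, C z -> 0 <= dot (A z) (z - w).
Proof.
split=> -[Cw hw]; split=> // z Cz; first exact/A_pseudomonotone/hw.
rewrite -oppr_le0.
apply: (@le0_forall_small _ _ (L * `|z - w| ^+ 2)) => t /andP[t0 t1].
have Cwt : C (w + t *: (z - w)) by apply: convex_set_segment => //; rewrite ltW.
have := hw _ Cwt; rewrite addrAC subrr add0r dotZr pmulr_rge0 // => ht.
have := dot_le (A (w + t *: (z - w)) - A w) (z - w).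
have := A_lip (w + t *: (z - w)) w.
rewrite addrAC subrr add0r normrZ (gtr0_norm t0) dotBl => hA.
have := ler_wpM2r (normr_ge0 (z - w)) hA; lra.
Qed.

Lemma VI_closed : closed (VI dot C A).
Proof.
move=> w clw; apply/minty; split=> [|z Cz].
  by apply: C_closed => B /clw[v [[Cv _] Bv]]; exists v.
have : closed [set v | dot (A z) v <= dot (A z) z].
  apply: (@preimage_closed _ _ (dot (A z)) [set t | t <= dot (A z) z]).
    by move=> v _; apply: cvg_dotr.
  exact: closed_le.
rewrite dotBr subr_ge0; apply => B /clw[v [/minty[_ hv] Bv]].
by exists v; split=> //=; rewrite -subr_ge0 -dotBr hv.
Qed.

Lemma VI_convex : convex_set (VI dot C A).
Proof.
move=> u v t; rewrite !inE => /minty[Cu hu] /minty[Cv hv].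
apply/minty; split=> [|z Cz].
  by apply/set_mem/C_convex; rewrite inE.
rewrite -[conv t u v]/(t%:num *: (u : H) + (1 - t%:num) *: (v : H)).
have := hu z Cz; have := hv z Cz; rewrite !dotBr dotDr !dotZr.
have : 0 <= t%:num by []. have : t%:num <= 1 by [].
by move: (t%:num) => a *; nra.
Qed.

(** The projection [P] onto the solution set is nonexpansive, so [P] after [f] is a contraction and
    [u] is its fixed point. *)
Lemma viscosity_point (f : H -> H) rho : VI dot C A !=set0 ->
  0 <= rho < 1 -> rho.-lipschitz f ->
  exists u, VI dot C A u /\ forall v, VI dot C A v -> dot (f u - u) (v - u) <= 0.
Proof.
move=> VI0 /andP[rho0 rho1] flip.
have /choice[P PP] : forall p, exists q, VI dot C A q /\
    forall v, VI dot C A v -> dot (p - q) (v - q) <= 0.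
  move=> p; have [q /is_metric_projP qP] :=
    metric_proj_exists p VI_closed VI_convex VI0.
  by exists q; apply: qP; exact: VI_convex.
have P_lip p q : `|P p - P q| <= `|p - q|.
  have [[Vp hp] [Vq hq]] := (PP p, PP q).
  have : `|P p - P q| ^+ 2 <= `|p - q| * `|P p - P q|.
    apply: le_trans (dot_le _ _); have := hp _ Vq; have := hq _ Vp.
    by rewrite -dot_norm !dotE (dotC (P q) (P p)); lra.
  have [->|] := eqVneq (`|P p - P q|) 0; first by rewrite normr_ge0.
  by rewrite expr2 => n0; rewrite ler_pM2r // lt_neqAle eq_sym n0 normr_ge0.
pose g0 u := P (f u).
pose g : {fun [set: H] >-> [set: H]} :=
  HB.pack g0 (isFun.Build H H [set: H] [set: H] g0 (fun _ _ => I)).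
have g_contr : is_contraction g.
  exists (NngNum rho0); split=> //= -[u v] _ /=.
  by rewrite (le_trans (P_lip _ _)) //; exact: (@flip (u, v) (conj I I)).
have [|u _ gu] := banach_fixed_point g_contr closedT; first by exists 0.
by exists u; have := PP (f u); rewrite -[P (f u)]/(g u) -gu.
Qed.

(** Expand the squares and add the projection inequality tested at [p] to
    [0 <= gam * dot (A y) (y - p)], which pseudomonotonicity yields. *)
Lemma tseng_descent gam s y p : 0 <= gam -> VI dot C A p -> C y ->
  (forall v, C v -> dot (s - gam *: A s - y) (v - y) <= 0) ->
  `|y - gam *: (A y - A s) - p| ^+ 2 <=
  `|s - p| ^+ 2 - `|s - y| ^+ 2 + (gam * `|A s - A y|) ^+ 2.
Proof.
move=> gam0 [Cp hp] Cy hy.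
have := hy _ Cp; have := mulr_ge0 gam0 (A_pseudomonotone (hp _ Cy)).
rewrite exprMn; move: (A s) (A y) => a b.
rewrite -!dot_norm !dotE (dotC y s) (dotC p s) (dotC p y).
by rewrite (dotC b a) (dotC a y) (dotC b y) (dotC p a) (dotC p b); lra.
Qed.

(** In [dot (A (y n)) (z - y n)] both factors converge only weakly. Pseudomonotonicity replaces
    [A (y n)] by the fixed vector [A (z + t *: v)], so that the weak limit can be taken, and [minty]
    concludes. *)
Lemma VI_weak_limit (y : nat -> H) w : seq_weakly_continuous_on C A ->
  (forall n, C (y n)) -> weakly_cvg y w ->
  (forall z e, C z -> 0 < e ->
    \forall n \near \oo, - e <= dot (A (y n)) (z - y n)) ->
  VI dot C A w.
Proof.
move=> Aw_cont Cy yw hy; have Cw := weakly_closed_convex C_closed C_convex Cy yw.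
have [Aw0|Aw0] := eqVneq (A w) 0; first by split=> // z _; rewrite Aw0 dot0l.
apply/minty; split=> // z Cz.
have Aw2 : `|A w| ^+ 2 != 0 by rewrite expf_neq0 // normr_eq0.
(* [dot (A (y n)) v] tends to 2, so perturbing [z] by [t *: v] makes
   [dot (A (y n)) (z - y n)] nonnegative. *)
have [v vAw] : exists v, dot v (A w) = 2.
  by exists ((2 / `|A w| ^+ 2) *: A w); rewrite dotZl dot_norm divfK.
have hv t : 0 < t -> 0 <= dot (A (z + t *: v)) (z + t *: v - w).
  move=> t0; rewrite dotBr subr_ge0.
  have yw' := (weakly_cvgP y w).1 yw (A (z + t *: v)).
  apply: (ler_cvg_to yw' (cvg_cst _)).
  have : \forall n \near \oo, 1 <= dot v (A (y n)).
    have Ayw := (weakly_cvgP _ _).1 (Aw_cont y w Cy yw) v.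
    apply: (cvgr_ge _ Ayw).
    by rewrite vAw; lra.
  move=> hv1; have hyt := hy z t Cz t0; near=> n.
  rewrite -subr_ge0 -dotBr; apply: A_pseudomonotone.
  have : 1 <= dot v (A (y n)) by near: n.
  have : - t <= dot (A (y n)) (z - y n) by near: n.
  rewrite !dotE (dotC v); nra.
(* By the Lipschitz bound, [hv] differs from the inequality at [z] by at most [t] times a
   constant. *)
rewrite -oppr_le0.
apply: (@le0_forall_small _ _ (`|A z| * `|v| + L * `|v| * (`|z - w| + `|v|))).
move=> t /andP[t0 t1]; have ht := hv t t0.
have i1 := dot_le (A z) v.
have i2 := dot_le (A (z + t *: v) - A z) (z + t *: v - w).
have i3 := A_lip (z + t *: v) z.
rewrite addrAC subrr add0r normrZ (gtr0_norm t0) in i3.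
have i4 : `|z + t *: v - w| <= `|z - w| + `|v|.
  rewrite addrAC (le_trans (ler_normD _ _)) // lerD2l normrZ (gtr0_norm t0).
  by rewrite ler_piMl.
have i5 := ler_pM (normr_ge0 _) (normr_ge0 _) i3 i4.
move: ht i2; rewrite !dotE; move: i1 i5; nra.
Unshelve. all: by end_near. Qed.

End variational_inequality.

(** * Residual and viscosity estimates *)

(** Dividing the projection inequality by [gam] costs [m^-1], and replacing [A s] by [A y] costs
    [L]. *)
Lemma VI_residual (A : H -> H) L m gam s y v : L.-lipschitz A ->
  0 < m <= gam -> dot (s - gam *: A s - y) (v - y) <= 0 ->
  - ((m^-1 + L) * `|s - y| * `|v - y|) <= dot (A y) (v - y).
Proof.
move=> A_lip /andP[m0 mgam]; rewrite addrAC dotBl dotZl => h1.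
have h2 := dot_le (A s - A y) (v - y).
have h3 : `|A s - A y| <= L * `|s - y| by exact: (@A_lip (s, y) (conj I I)).
have := ler_wpM2r (normr_ge0 (v - y)) h3.
have h4 := norm_dot_le (s - y) (v - y).
have P0 : 0 <= `|s - y| * `|v - y| by rewrite mulr_ge0.
have gam0 := lt_le_trans m0 mgam.
have h5 : - (m^-1 * (`|s - y| * `|v - y|)) <= dot (A s) (v - y).
  have : - (`|s - y| * `|v - y|) / gam <= dot (A s) (v - y).
    by rewrite ler_pdivrMr //; move: h4; rewrite ler_norml => /andP[]; lra.
  apply: le_trans; rewrite mulNr lerN2 mulrC ler_wpM2r // lef_pV2 ?posrE //.
by move: h2; rewrite dotBl; lra.
Qed.

Lemma viscosity_point_unique (f : H -> H) rho u v : rho < 1 ->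
  rho.-lipschitz f -> dot (f u - u) (v - u) <= 0 ->
  dot (f v - v) (u - v) <= 0 -> u = v.
Proof.
move=> rho1 f_lip hu hv.
have hf : `|f u - f v| <= rho * `|u - v| by exact: (@f_lip (u, v) (conj I I)).
have h1 := ler_wpM2r (normr_ge0 (u - v)) hf.
have h2 := dot_le (f u - f v) (u - v).
have : (1 - rho) * `|u - v| ^+ 2 <= 0.
  suff : `|u - v| ^+ 2 <= dot (f u - f v) (u - v) by lra.
  by move: hu hv; rewrite -dot_norm !dotE (dotC v u); lra.
rewrite pmulr_rle0 ?subr_gt0 // exprn_even_le0 //= normr_eq0 subr_eq0.
by move/eqP.
Qed.

(** Used with [p = f z], [q = z], [v = f u]: a part contracting towards [u] plus the drift
    [t *: (f u - u)]. *)
Lemma viscosity_shift t p q v u : t *: p + (1 - t) *: q - u =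
  t *: (p - v) + (1 - t) *: (q - u) + t *: (v - u).
Proof.
rewrite [RHS]addrAC -scalerDr subrKA !scalerBr addrACA -opprD -scalerDl.
by rewrite [t + _]addrC subrK scale1r.
Qed.

(** From [|b + c|^2 <= |b|^2 + 2 <c, b + c>] with [c] the drift; the squared contraction factor is
    at most the factor itself. *)
Lemma viscosity_step (f : H -> H) rho t z u : 0 <= rho < 1 ->
  rho.-lipschitz f -> 0 <= t <= 1 ->
  `|t *: f z + (1 - t) *: z - u| ^+ 2 <= (1 - (1 - rho) * t) * `|z - u| ^+ 2
    + 2 * t * dot (f u - u) (t *: f z + (1 - t) *: z - u).
Proof.
move=> /andP[rho0 rho1] f_lip /andP[t0 t1].
set b := t *: (f z - f u) + (1 - t) *: (z - u).
have -> : t *: f z + (1 - t) *: z - u = b + t *: (f u - u).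
  exact: viscosity_shift.
have hb : `|b| <= (1 - (1 - rho) * t) * `|z - u|.
  have h : `|f z - f u| <= rho * `|z - u| by exact: (@f_lip (z, u) (conj I I)).
  have ht := ler_wpM2l t0 h; rewrite (le_trans (ler_normD _ _)) // !normrZ.
  by rewrite (ger0_norm t0) ger0_norm ?subr_ge0 //; lra.
have hb2 : `|b| ^+ 2 <= (1 - (1 - rho) * t) * `|z - u| ^+ 2.
  have : `|b| ^+ 2 <= ((1 - (1 - rho) * t) * `|z - u|) ^+ 2.
    by rewrite ler_pXn2r ?nnegrE // (le_trans _ hb).
  move=> /le_trans; apply; rewrite exprMn ler_wpM2r ?sqr_ge0 //.
  have : 0 <= 1 - (1 - rho) * t by nra.
  have : 1 - (1 - rho) * t <= 1 by nra.
  by move: (1 - (1 - rho) * t) => r; nra.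
rewrite (normD_sqr b) dotDr !dotZr dot_norm normrZ exprMn (ger0_norm t0) (dotC b).
have := sqr_ge0 `|f u - u|; nra.
Qed.

Lemma viscosity_step_norm (f : H -> H) rho t z u :
  rho.-lipschitz f -> 0 <= t <= 1 ->
  `|t *: f z + (1 - t) *: z - u| <=
  (1 - (1 - rho) * t) * `|z - u| + t * `|f u - u|.
Proof.
move=> f_lip /andP[t0 t1].
have -> : t *: f z + (1 - t) *: z - u =
    t *: (f z - f u) + (1 - t) *: (z - u) + t *: (f u - u).
  exact: viscosity_shift.
have h : `|f z - f u| <= rho * `|z - u| by exact: (@f_lip (z, u) (conj I I)).
have ht := ler_wpM2l t0 h.
rewrite (le_trans (ler_normD _ _)) // normrZ (ger0_norm t0) lerD2r.
rewrite (le_trans (ler_normD _ _)) // !normrZ (ger0_norm t0).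
by rewrite (ger0_norm (_ : 0 <= 1 - t)) ?subr_ge0 //; lra.
Qed.

(** * Convergence of the algorithm *)

Section algorithm.
Variables (C : set H) (A f : H -> H) (eps vphi : nat -> R) (L rho delta phi : R).
Variables (x s y z : nat -> H) (gam : nat -> R).
Hypotheses (C_closed : closed C) (C_convex : convex_set C).
Hypotheses (A_pseudomonotone : pseudomonotone dot A).
Hypotheses (L_gt0 : 0 < L) (A_lipschitz : L.-lipschitz A).
Hypothesis A_weak : seq_weakly_continuous_on C A.
Hypotheses (rho01 : 0 <= rho < 1) (f_lipschitz : rho.-lipschitz f).
Hypothesis eps_gt0 : forall n, (1 <= n)%N -> 0 < eps n.
Hypothesis vphi01 : forall n, (1 <= n)%N -> 0 < vphi n < 1.
Hypothesis eps_vphi : eps n / vphi n @[n --> \oo] --> (0 : R).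
Hypothesis vphi_cvg0 : vphi n @[n --> \oo] --> (0 : R).
Hypothesis vphi_sum : \sum_(1 <= k < n.+1) vphi k @[n --> \oo] --> +oo.
Hypotheses (delta_gt0 : 0 < delta) (gam1_gt0 : 0 < gam 1%N) (phi01 : 0 < phi < 1).
Hypothesis alg : inertial_viscosity_tseng C A f eps vphi delta phi x s y z gam.

Let A_lip u v : `|A u - A v| <= L * `|u - v|.
Proof. exact: (@A_lipschitz (u, v) (conj I I)). Qed.

Let near_ge1 : \forall n \near \oo, (1 <= n)%N.
Proof. by exists 1%N. Qed.

Let eps_le r : 0 < r -> \forall n \near \oo, eps n <= r * vphi n.
Proof.
move=> r0; have er := cvgr_le _ eps_vphi _ r0; near=> n.
have n1 : (1 <= n)%N by near: n.
have /andP[v0 _] := vphi01 n1; rewrite -ler_pdivrMr //; near: n; exact: er.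
Unshelve. all: by end_near. Qed.

Lemma y_proj n : (1 <= n)%N -> C (y n) /\
  forall v, C v -> dot (s n - gam n *: A (s n) - y n) (v - y n) <= 0.
Proof. by move=> n1; apply/is_metric_projP => //; apply: (tseng_y alg). Qed.

(** The cap in the inertial coefficient keeps the displacement below [eps n]; if [x n = x n.-1], the
    default [delta] multiplies 0. *)
Lemma inertial_step_le n u : (1 <= n)%N -> `|s n - u| <= `|x n - u| + eps n.
Proof.
move=> n1; rewrite (tseng_s alg n1) addrAC (le_trans (ler_normD _ _)) // lerD2l.
rewrite normrZ; case: eqVneq => [->|xn] /=.
  by rewrite subrr normr0 mulr0 ltW // eps_gt0.
have d0 : 0 < `|x n - x n.-1| by rewrite normr_gt0 subr_eq0.
rewrite ger0_norm; last first.
  by rewrite le_min (ltW delta_gt0) andbT divr_ge0 // ltW // eps_gt0.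
by rewrite -ler_pdivlMr // ge_min lexx.
Qed.

(** The update rule controls [gam n.+1], while step [n] uses [gam n]; [z_descent] bridges this shift
    by the ratio of the two. *)
Lemma gam_residual n : (1 <= n)%N ->
  gam n.+1 * `|A (s n) - A (y n)| <= phi * `|s n - y n|.
Proof.
move=> n1; rewrite (tseng_gam alg n1); have [->|d0] /= := eqVneq.
  by rewrite normr0 mulr0 mulr_ge0 //; case/andP: phi01 => /ltW.
by rewrite -ler_pdivlMr ?normr_gt0 // ge_min lexx.
Qed.

Lemma gam_decr n : (1 <= n)%N -> gam n.+1 <= gam n.
Proof.
by move=> n1; rewrite (tseng_gam alg n1); case: ifP; rewrite // ge_min lexx orbT.
Qed.

(** By the Lipschitz bound each quotient in the update is at least [phi / L]. *)
Lemma gam_lower_bound : exists2 m, 0 < m & forall n, (1 <= n)%N -> m <= gam n.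
Proof.
have /andP[phi0 _] := phi01.
exists (Num.min (gam 1%N) (phi / L)); first by rewrite lt_min gam1_gt0 divr_gt0.
case=> // n _; elim: n => [|n IH]; first by rewrite ge_min lexx.
rewrite (tseng_gam alg (ltn0Sn n)); have [//|d0] /= := eqVneq.
rewrite le_min IH andbT ge_min; apply/orP; right.
have d1 : 0 < `|A (s n.+1) - A (y n.+1)| by rewrite normr_gt0.
rewrite ler_pdivlMr // mulrAC ler_pdivrMr // -mulrA ler_pM2l // mulrC.
exact: A_lip.
Qed.

Lemma z_descent u : VI dot C A u -> \forall n \near \oo,
  `|z n - u| ^+ 2 <= `|s n - u| ^+ 2 -
    (1 - ((1 + phi) / 2) ^+ 2) * `|s n - y n| ^+ 2.
Proof.
move=> VIu; have /andP[phi0 phi1] := phi01.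
have [m m0 hm] := gam_lower_bound.
(* The ratio [c] enlarges [phi] to the midpoint of [phi] and 1, still below 1. *)
have [c c1 cphi] : exists2 c, 1 < c & c * phi = (1 + phi) / 2.
  by exists ((1 + phi) / 2 / phi);
    [rewrite ltr_pdivlMr //; lra|rewrite divfK ?gt_eqF].
have [N _ hN] := nonincreasing_ratio m0 (u := fun n => gam n.+1)
  (fun n => hm n.+1 isT) (fun n => @gam_decr n.+1 isT) c1.
exists N.+1 => // -[//|n] /= Nn; have n1 : (1 <= n.+1)%N by [].
have [Cy hy] := y_proj n1.
have gam0 : 0 <= gam n.+1 by rewrite (le_trans (ltW m0)) ?hm.
rewrite (tseng_z alg n1).
apply: le_trans (tseng_descent A_pseudomonotone gam0 VIu Cy hy) _.
have hr : gam n.+1 * `|A (s n.+1) - A (y n.+1)| <=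
    (1 + phi) / 2 * `|s n.+1 - y n.+1|.
  have := ler_wpM2r (normr_ge0 (A (s n.+1) - A (y n.+1))) (hN n Nn).
  have := ler_wpM2l (ltW (lt_trans ltr01 c1)) (gam_residual n1).
  by rewrite -cphi; lra.
have : (gam n.+1 * `|A (s n.+1) - A (y n.+1)|) ^+ 2 <=
    ((1 + phi) / 2 * `|s n.+1 - y n.+1|) ^+ 2.
  rewrite ler_pXn2r ?nnegrE ?mulr_ge0 //; lra.
by rewrite [((1 + phi) / 2 * _) ^+ 2]exprMn; lra.
Qed.

Lemma z_le u : VI dot C A u -> \forall n \near \oo, `|z n - u| <= `|x n - u| + eps n.
Proof.
move=> VIu; near=> n; have n1 : (1 <= n)%N by near: n.
have hz := near (z_descent VIu) n; apply: le_trans (inertial_step_le u n1).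
rewrite -(ler_pXn2r (n := 2)) ?nnegrE //; apply: le_trans (hz _) _ => //.
by rewrite gerBl mulr_ge0 ?sqr_ge0 //; case/andP: phi01; nra.
Unshelve. all: by end_near. Qed.

Lemma x_bounded u : VI dot C A u ->
  exists2 M, 0 <= M & \forall n \near \oo, `|x n - u| <= M.
Proof.
move=> VIu; have /andP[rho0 rho1] := rho01.
have [N _ hN] : \forall n \near \oo, [/\ (1 <= n)%N,
    `|z n - u| <= `|x n - u| + eps n & eps n <= 1 * vphi n].
  near=> n; split; near: n; [exact: near_ge1|exact: z_le|exact: eps_le].
(* The second term makes [(1 - rho) * M] dominate the drift [|f u - u|], the [+ 1] absorbing
   [eps n <= vphi n]. *)
pose M := Num.max `|x N - u| ((`|f u - u| + 1) / (1 - rho)).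
exists M; first by rewrite le_max normr_ge0.
exists N => // n /= /subnK <-; rewrite addnC; elim: (n - N)%N => [|k IH].
  by rewrite addn0 le_max lexx.
rewrite addnS; have [n1 hz he] := hN _ (leq_addr k N).
move: (N + k)%N n1 hz he IH => j j1 hz he IH.
have /andP[v0 v1] := vphi01 j1.
have hM : `|f u - u| + 1 <= (1 - rho) * M.
  by rewrite mulrC -ler_pdivrMr ?subr_gt0 // le_max lexx orbT.
have v01 : 0 <= vphi j <= 1 by rewrite !ltW.
rewrite (tseng_x alg j1).
apply: le_trans (viscosity_step_norm (z j) u f_lipschitz v01) _.
have c0 : 0 <= 1 - (1 - rho) * vphi j by nra.
have := ler_wpM2l c0 (le_trans hz (lerD IH he)).
have : (1 - (1 - rho) * vphi j) * vphi j <= vphi j by nra.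
have := ler_wpM2l (ltW v0) hM; lra.
Unshelve. all: by end_near. Qed.

(** Along [nu] the residual in [VI_residual] tends to 0, so [VI_weak_limit] applies. *)
Lemma VI_cluster (nu : nat -> nat) w :
  (forall k, (k <= nu k)%N) -> (forall k, (1 <= nu k)%N) ->
  `|s (nu k) - y (nu k)| @[k --> \oo] --> (0 : R) ->
  (exists B, forall k, `|y (nu k)| <= B) ->
  weakly_cvg (y \o nu) w -> VI dot C A w.
Proof.
move=> nuk nu1 sy0 [B yB] yw.
apply: (VI_weak_limit C_closed C_convex A_pseudomonotone A_lipschitz A_weak) yw _.
  by move=> k; have [] := y_proj (nu1 k).
move=> v e Cv e0; have [m m0 hm] := gam_lower_bound.
have B0 : 0 <= B by apply: le_trans (yB 0%N).
pose c := (m^-1 + L) * (`|v| + B + 1).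
have mL : 0 < m^-1 + L by rewrite addr_gt0 // invr_gt0.
have c0 : 0 < c by rewrite mulr_gt0 //; have := normr_ge0 v; lra.
have syc := cvgr_le _ sy0 _ (divr_gt0 e0 c0); near=> k.
have hk : `|s (nu k) - y (nu k)| * c <= e.
  by rewrite -ler_pdivlMr //; near: k; exact: syc.
have [_ hy] := y_proj (nu1 k).
have mg : 0 < m <= gam (nu k) by rewrite m0 hm.
apply: le_trans _ (VI_residual A_lipschitz mg (hy _ Cv)).
rewrite lerN2; apply: le_trans hk; rewrite /c.
have : `|v - y (nu k)| <= `|v| + B + 1.
  by have := ler_normB v (y (nu k)); have := yB k; lra.
move=> hv; have sy1 := normr_ge0 (s (nu k) - y (nu k)).
by have := ler_wpM2l (mulr_ge0 sy1 (ltW mL)) hv; lra.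
Unshelve. all: by end_near. Qed.

Lemma gam_le1 n : (1 <= n)%N -> gam n <= gam 1%N.
Proof.
by case: n => // n _; elim: n => // n IH; apply: le_trans IH; exact: gam_decr.
Qed.

(** Otherwise bad indices exist with [|s n - y n|] arbitrarily small. A weak limit [w] of [y] along
    them solves the inequality, so [hu] applies to [w]; as [x n.+1] is close to [y n], this
    contradicts badness. *)
Lemma viscosity_direction_le u eta : VI dot C A u ->
  (forall v, VI dot C A v -> dot (f u - u) (v - u) <= 0) -> 0 < eta ->
  exists2 tau, 0 < tau & \forall n \near \oo,
    `|s n - y n| < tau -> dot (f u - u) (x n.+1 - u) <= eta.
Proof.
move=> VIu hu eta0; have /andP[rho0 rho1] := rho01.
have [M M0 xM] := x_bounded VIu.
pose good n := [/\ (1 <= n)%N, `|x n - u| <= M,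
  `|z n - u| <= `|x n - u| + eps n & eps n <= 1 * vphi n].
have near_good : \forall n \near \oo, good n.
  near=> n; split; near: n; [exact: near_ge1|exact: xM|exact: z_le|exact: eps_le].
apply: contrapT => none.
have /choice[N NP] : forall k : nat, exists n, [/\ (k <= n)%N, good n,
    `|s n - y n| < k.+1%:R^-1 & eta < dot (f u - u) (x n.+1 - u)].
  move=> k; apply: contrapT => hk; apply: none.
  exists k.+1%:R^-1; first by rewrite invr_gt0.
  near=> n => syn; rewrite leNgt; apply/negP => hn; apply: hk; exists n.
  by split=> //; near: n; [exists k|exact: near_good].
have goodb n : good n -> [/\ `|s n - u| <= M + 1, `|z n - u| <= M + 1
    & 0 < vphi n < 1].
  move=> [n1 hx hz he]; have v01 := vphi01 n1; split=> //.
    by have := inertial_step_le u n1; move: v01 => /andP[_ v1]; lra.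
  by move: v01 => /andP[_ v1]; lra.
have yB k : `|(y \o N) k| <= `|u| + M + 2.
  have [_ /goodb[sM _ _] syk _] := NP k; rewrite /=.
  have /(lt_le_trans syk) {}syk : k.+1%:R^-1 <= 1 :> R by rewrite invf_le1 // ler1n.
  have -> : y (N k) = s (N k) - u - (s (N k) - y (N k)) + u.
    by rewrite opprB [_ - u + _]addrC subrKA subrK.
  have := ler_normD (s (N k) - u - (s (N k) - y (N k))) u.
  have := ler_normB (s (N k) - u) (s (N k) - y (N k)); lra.
have [sigma [w [sigmak yw]]] := bounded_weakly_cvg_subseq yB.
pose nu k := N (sigma k).
have nuk k : (k <= nu k)%N.
  by have [h _ _ _] := NP (sigma k); rewrite (leq_trans _ h).
have nu1 k : (1 <= nu k)%N by have [_ [h _ _ _] _ _] := NP (sigma k).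
have near_nu (P : set nat) : (\forall n \near \oo, P n) ->
    \forall k \near \oo, P (nu k).
  move=> [k0 _ hk0]; exists k0 => // k /= k0k.
  by apply: hk0; exact: leq_trans (nuk k).
have sy0 : `|s (nu k) - y (nu k)| @[k --> \oo] --> (0 : R).
  apply: (squeeze_cvgr (f := fun=> 0) (h := fun k => k.+1%:R^-1)).
  - apply: nearW => k; rewrite normr_ge0 /=; have [_ _ /ltW h _] := NP (sigma k).
    by apply: le_trans h _; rewrite lef_pV2 ?posrE // ler_nat ltnS.
  - exact: cvg_cst.
  - exact: cvg_harmonic.
have VIw : VI dot C A w.
  by apply: VI_cluster nuk nu1 sy0 _ yw; exists (`|u| + M + 2) => k; exact: yB.
have hw : dot (f u - u) w < dot (f u - u) u + eta / 2.
  by have := hu _ VIw; rewrite dotBr; lra.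
have near_y := cvgr_lt _ ((weakly_cvgP _ _).1 yw (f u - u)) _ hw.
(* The bound [eta] is shared out: [eta / 2] for [y n - u], and [eta / 4] each for [z n - y n] and
   [vphi n *: (f (z n) - z n)], where [K] bounds [f (z n) - z n]. *)
pose d := `|f u - u|; have d0 : 0 <= d := normr_ge0 _.
pose K := 2 * (M + 1) + d; have K0 : 0 <= K by rewrite /K; lra.
have gL0 : 0 <= gam 1%N * L by rewrite mulr_ge0 ?ltW.
have c1 : 0 < 4 * (d * K + 1) by have := mulr_ge0 d0 K0; lra.
have c2 : 0 < 4 * (d * (gam 1%N * L) + 1) by have := mulr_ge0 d0 gL0; lra.
have near_v := near_nu _ (cvgr_le _ vphi_cvg0 _ (divr_gt0 eta0 c1)).
have near_s := cvgr_le _ sy0 _ (divr_gt0 eta0 c2).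
have [k] : exists k, [/\ dot (f u - u) (y (nu k)) < dot (f u - u) u + eta / 2,
    vphi (nu k) <= eta / (4 * (d * K + 1)) &
    `|s (nu k) - y (nu k)| <= eta / (4 * (d * (gam 1%N * L) + 1))].
  apply: (filter_ex (F := \oo)); near=> k; split; near: k.
  - exact: near_y.
  - exact: near_v.
  - exact: near_s.
have [_ good_k _ big] := NP (sigma k); have [n1 _ _ _] := good_k.
have [_ zM /andP[v0 _]] := goodb _ good_k; rewrite -/(nu k) in n1 zM v0 big.
move: (nu k) n1 zM v0 big => n n1 zM v0 big.
rewrite !ler_pdivlMr // => -[hy hv hs].
move: big; rewrite ltNge => /negP; apply.
have fzz : `|f (z n) - z n| <= K.
  have -> : f (z n) - z n = (f (z n) - f u) + (f u - u) - (z n - u).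
    by rewrite opprB addrA subrKA subrK.
  have hf : `|f (z n) - f u| <= rho * `|z n - u|.
    exact: (@f_lipschitz (z n, u) (conj I I)).
  have := ler_normB (f (z n) - f u + (f u - u)) (z n - u).
  have := ler_normD (f (z n) - f u) (f u - u).
  have : rho * `|z n - u| <= `|z n - u| by rewrite ler_piMl // ltW.
  by rewrite /K /d; lra.
have zy : `|z n - y n| <= gam 1%N * L * `|s n - y n|.
  rewrite (tseng_z alg n1) addrAC subrr add0r normrN normrZ.
  have [m m0 hm] := gam_lower_bound.
  have g0 : 0 <= gam n by rewrite (le_trans (ltW m0)) ?hm.
  rewrite (ger0_norm g0) -mulrA ler_pM //; first exact: gam_le1.
  by rewrite distrC; exact: A_lip.
have -> : x n.+1 - u = (y n - u) + (z n - y n) + vphi n *: (f (z n) - z n).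
  rewrite (tseng_x alg n1) [y n - u + _]addrC subrKA scalerBr scalerBl scale1r.
  rewrite [RHS]addrC [RHS]addrA; congr (_ - u).
  by rewrite [z n - _]addrC addrA.
rewrite dotDr dotZr dotDr dotBr.
have i1 := dot_le (f u - u) (z n - y n).
have i2 := dot_le (f u - u) (f (z n) - z n).
have i3 := ler_wpM2l d0 zy; have i4 := ler_wpM2l d0 fzz.
have i5 := ler_wpM2l (ltW v0) (le_trans i2 i4).
have e1 : d * (gam 1%N * L * `|s n - y n|) <= eta / 4.
  have := normr_ge0 (s n - y n); lra.
have e2 : vphi n * (d * K) <= eta / 4 by lra.
move: i1; rewrite -/d; lra.
Unshelve. all: by end_near. Qed.

Lemma algorithm_cvg u : VI dot C A u ->
  (forall v, VI dot C A v -> dot (f u - u) (v - u) <= 0) ->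
  x n @[n --> \oo] --> u.
Proof.
move=> VIu hu; have /andP[rho0 rho1] := rho01; have /andP[phi0 phi1] := phi01.
apply/cvgrPdist_le => e e0.
pose eta := e ^+ 2 / 2; have eta0 : 0 < eta by rewrite divr_gt0 ?exprn_gt0.
have c0 : 0 < 1 - rho by lra.
suff : \forall n \near \oo, `|x n - u| ^+ 2 <= 2 * eta.
  apply: filterS => n; rewrite /eta mulrC divfK // => h.
  by rewrite distrC -(ler_pXn2r (n := 2)) ?nnegrE // ltW.
apply: (contractive_recurrence_le c0 eta0 vphi_sum).
have [M M0 xM] := x_bounded VIu.
have xM1 : \forall n \near \oo, `|x n.+1 - u| <= M.
  by case: xM => N _ hN; exists N => // n /= Nn; exact: hN (leqW Nn).
(* Multiplied by [2 * vphi n], this becomes [alpha * eta / 2], half of the allowed error. *)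
have eta1 : 0 < (1 - rho) * eta / 4 by rewrite divr_gt0 ?mulr_gt0.
have [tau tau0 htau] := viscosity_direction_le VIu hu eta1.
pose kappa := 1 - ((1 + phi) / 2) ^+ 2.
have kappa0 : 0 < kappa by rewrite /kappa; nra.
pose d := `|f u - u|; have d0 : 0 <= d := normr_ge0 _.
(* With [eps n] below this times [vphi n], the inertial error [(2 * M + 1) * eps n] is at most the
   other half. *)
have r0 : 0 < (1 - rho) * eta / (2 * (2 * M + 1)).
  by rewrite divr_gt0 ?mulr_gt0 //; lra.
have q0 : 0 < kappa * tau ^+ 2 / (4 * (d * M + 1)).
  by rewrite divr_gt0 ?mulr_gt0 ?exprn_gt0 //; have := mulr_ge0 d0 M0; lra.
have near_v := cvgr_le _ vphi_cvg0 _ q0.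
have near_v2 : \forall n \near \oo, vphi n <= 2^-1.
  by apply: (cvgr_le _ vphi_cvg0); lra.
near=> n.
have n1 : (1 <= n)%N by near: n.
have /andP[v0 v1] := vphi01 n1.
have v01 : 0 <= vphi n <= 1 by rewrite !ltW.
have hx : `|x n - u| <= M by near: n.
have hx1 : `|x n.+1 - u| <= M by near: n.
have e_gt0 := eps_gt0 n1.
have he : eps n <= 1 * vphi n by near: n; exact: eps_le.
have her : eps n <= (1 - rho) * eta / (2 * (2 * M + 1)) * vphi n.
  by near: n; exact: eps_le.
have hz : `|z n - u| ^+ 2 <= `|s n - u| ^+ 2 - kappa * `|s n - y n| ^+ 2.
  by near: n; exact: z_descent.
have ht : `|s n - y n| < tau ->
  dot (f u - u) (x n.+1 - u) <= (1 - rho) * eta / 4 by near: n.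
have hDx := dot_le (f u - u) (x n.+1 - u).
have hv : vphi n <= kappa * tau ^+ 2 / (4 * (d * M + 1)).
  by near: n; exact: near_v.
have hv2 : vphi n <= 2^-1 by near: n.
have [alpha alphaE] : exists alpha, alpha = (1 - rho) * vphi n.
  by exists ((1 - rho) * vphi n).
have alpha0 : 0 <= alpha by rewrite alphaE mulr_ge0 // ltW.
have alpha1 : alpha <= 2^-1 by rewrite alphaE; nra.
have := viscosity_step (z n) u rho01 f_lipschitz v01.
rewrite -(tseng_x alg n1) -alphaE; move: (dot _ _) ht hDx => D ht hDx hstep.
split; first by lra.
have hs : `|s n - u| ^+ 2 <= `|x n - u| ^+ 2 + alpha * eta / 2.
  have h1 : `|s n - u| ^+ 2 <= (`|x n - u| + eps n) ^+ 2.
    by rewrite ler_pXn2r ?nnegrE ?addr_ge0 ?inertial_step_le // ltW.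
  have h2 : eps n * (2 * (2 * M + 1)) <= (1 - rho) * eta * vphi n.
    by rewrite -ler_pdivlMr ?mulr_gt0 // 1?mulrAC //; lra.
  have h3 := ler_wpM2l (ltW e_gt0) hx.
  have h4 : eps n * eps n <= eps n by rewrite ler_piMr ?ltW //; lra.
  by rewrite alphaE; lra.
have alpha_eta : 0 <= alpha * (alpha * eta) by rewrite !mulr_ge0 // ltW.
have a1 : 0 <= 1 - alpha by lra.
apply: (le_trans hstep).
have [syt|syt] := ltP `|s n - y n| tau.
  have hD := ler_wpM2l (ltW v0) (ht syt).
  have hk := mulr_ge0 (ltW kappa0) (sqr_ge0 `|s n - y n|).
  have hz' : `|z n - u| ^+ 2 <= `|x n - u| ^+ 2 + alpha * eta / 2 by lra.
  have := ler_wpM2l a1 hz'.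
  have : vphi n * ((1 - rho) * eta / 4) = alpha * eta / 4 by rewrite alphaE; lra.
  lra.
(* Large residual: as [alpha <= 1 / 2], at least half of [kappa * tau ^+ 2] survives, and by [hv]
   this covers [2 * vphi n * d * M]. *)
have hk : kappa * tau ^+ 2 <= kappa * `|s n - y n| ^+ 2.
  by rewrite ler_pM2l // ler_pXn2r ?nnegrE // ltW.
have hz' : `|z n - u| ^+ 2 <= `|x n - u| ^+ 2 + alpha * eta / 2 - kappa * tau ^+ 2.
  lra.
have hD := ler_wpM2l (ltW v0) (le_trans hDx (ler_wpM2l d0 hx1)).
have hkt : 0 <= (2^-1 - alpha) * (kappa * tau ^+ 2).
  by rewrite mulr_ge0 ?subr_ge0 // mulr_ge0 ?sqr_ge0 // ltW.
have hv3 : vphi n * (4 * (d * M + 1)) <= kappa * tau ^+ 2.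
  by rewrite -ler_pdivlMr //; have := mulr_ge0 d0 M0; lra.
have := mulr_ge0 alpha0 (ltW eta0).
have := ler_wpM2l a1 hz'; lra.
Unshelve. all: by end_near. Qed.

End algorithm.

End hilbert.

Theorem theorem3p1 (R : realType) (H : completeNormedModType R)
    (dot : {dot H for idfun}) (hdot : induces_norm dot)
    (C : set H) (A f : H -> H) (eps vphi : nat -> R) (L rho : R)
    (C1_closed : closed C) (C1_convex : convex_set C) (C1_nonempty : C !=set0)
    (C2 : VI dot C A !=set0)
    (C3_pseudomonotone : pseudomonotone dot A)
    (C3_L_gt0 : 0 < L) (C3_lipschitz : L.-lipschitz A)
    (C3_weak : seq_weakly_continuous_on C A)
    (C4_rho : 0 <= rho < 1) (C4_contractive : rho.-lipschitz f)
    (C5_eps_gt0 : forall n, (1 <= n)%N -> 0 < eps n)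
    (C5_vphi : forall n, (1 <= n)%N -> 0 < vphi n < 1)
    (C5_ratio : eps n / vphi n @[n --> \oo] --> (0 : R))
    (C5_vphi_cvg0 : vphi n @[n --> \oo] --> (0 : R))
    (C5_vphi_sum : \sum_(1 <= k < n.+1) vphi k @[n --> \oo] --> +oo)
    (delta gam1 phi : R) (x0 x1 : H)
    (delta_gt0 : 0 < delta) (gam1_gt0 : 0 < gam1) (hphi : 0 < phi < 1)
    (x s y z : nat -> H) (gam : nat -> R)
    (x_0 : x 0%N = x0) (x_1 : x 1%N = x1) (gam_1 : gam 1%N = gam1)
    (alg : inertial_viscosity_tseng C A f eps vphi delta phi x s y z gam) :
  exists u : H,
    unique (fun v => VI dot C A v /\ is_metric_proj (VI dot C A) (f v) v) u
    /\ x n @[n --> \oo] --> u.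
Proof.
have VIclosed := VI_closed hdot C1_closed C1_convex C3_pseudomonotone C3_lipschitz.
have VIconvex := VI_convex hdot C1_convex C3_pseudomonotone C3_lipschitz.
have [u [VIu hu]] := viscosity_point hdot C1_closed C1_convex C3_pseudomonotone
  C3_lipschitz C2 C4_rho C4_contractive.
exists u; split; last first.
  rewrite -gam_1 in gam1_gt0.
  exact: (algorithm_cvg hdot C1_closed C1_convex C3_pseudomonotone C3_L_gt0
    C3_lipschitz C3_weak C4_rho C4_contractive C5_eps_gt0 C5_vphi C5_ratio
    C5_vphi_cvg0 C5_vphi_sum delta_gt0 gam1_gt0 hphi alg VIu hu).
split=> [|v [VIv /(is_metric_projP hdot _ _ VIconvex)[_ hv]]].
  by split=> //; apply/(is_metric_projP hdot _ _ VIconvex).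
have /andP[_ rho1] := C4_rho.
exact: (viscosity_point_unique hdot rho1 C4_contractive (hu _ VIv) (hv _ VIu)).
Qed.
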